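(* Let $\mathcal{H}$ be an infinite-dimensional separable Hilbert space, let $A$ be a bounded linear operator on $\mathcal{H}$, and let $\{g_j\}_{j\in\Lambda}\subset\mathcal{H}$ be a Bessel sequence with Bessel bound $\beta>0$. Consider the non-uniform discrete dynamical system generated by $A$ with arbitrary initial states $x_0,x_{-2}\in\mathcal{H}$ and arbitrary source term $w\in W=\mathcal{H}$. Then the source term $w$ can be stably recovered from the measurements $D(x_0,x_{-2},w)=[\langle x_\lambda,g_j\rangle]_{\lambda\in[2K],\,j\in\Lambda}$ for some $K\in\mathbb{N}$ (that is, for some finite $[2K]$ with $1\le|[2K]|<\infty$) if and only if $\{g_j\}_{j\in\Lambda}$ is a frame for $\mathcal{H}$.
   Context: Let $N\in\mathbb{N}$, $N\ge1$, and let $r$ be a fixed odd integer coprime with $N$ with $1\le r\le 2N-1$. Put $\Lambda=\{0,\tfrac{r}{N}\}+2\mathbb{Z}\subset\mathbb{R}$, and for $K\in\mathbb{N}$, $K\ge1$, put $[2K]=\{2m,\,2m+\tfrac rN: m\in\mathbb{Z},\,-K\le m\le K-1\}\subset\Lambda$. $\mathbb{Z}^+$ and $\mathbb{Z}^-$ denote the positive and negative integers. The Hilbert space $\mathcal{H}$ is real or complex with scalar field $\mathbb{F}\in\{\mathbb{R},\mathbb{C}\}$; all sequences and matrices have entries in $\mathbb{F}$. Non-uniform discrete dynamical system: given a bounded linear operator $A$ on $\mathcal{H}$, a closed subspace $W$ of $\mathcal{H}$, a source term $w\in W$ and initial states $x_0,x_{-2}\in\mathcal{H}$, the states $x_\lambda\in\mathcal{H}$,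 $\lambda\in\Lambda$, are determined by $$x_{\lambda+\frac rN}=Ax_\lambda+w\ (\lambda\in2\mathbb{Z}),\quad x_{\lambda+2-\frac rN}=Ax_\lambda+w\ (\lambda\in(2\mathbb{Z}^++\tfrac rN)\cup\{\tfrac rN\}),\quad x_{\lambda-2-\frac rN}=Ax_\lambda+w\ (\lambda\in2\mathbb{Z}^-+\tfrac rN).$$ Bessel sequence with Bessel bound $\beta$: $\sum_{j}|\langle f,g_j\rangle|^2\le\beta\|f\|^2$ for all $f\in\mathcal{H}$. Frame for $\mathcal{H}$: there are constants $\alpha_0,\beta_0>0$ with $\alpha_0\|f\|^2\le\sum_{j}|\langle f,g_j\rangle|^2\le\beta_0\|f\|^2$ for all $f\in\mathcal{H}$. $\mathcal{B}(\ell^2(\Lambda),\mathbb{F}^{[2K]})$ is the Banach space of matrices $T=[a_{ij}]_{i\in[2K],\,j\in\Lambda}$ whose rows $r_i=(a_{ij})_{j\in\Lambda}$ all belong to $\ell^2(\Lambda)$, with norm $\|T\|=\sum_{i\in[2K]}\|r_i\|_{\ell^2(\Lambda)}$. The source term $w\in W$ can be stably recovered from the measurements indexed by $[2K]$ if there is a bounded linear operator $\mathscr{R}:\mathcal{B}(\ell^2(\Lambda),\mathbb{F}^{[2K]})\to\mathcal{H}$ such that $\mathscr{R}\big([\langle x_\lambda,g_j\rangle]_{\lambda\in[2K],\,j\in\Lambda}\big)=w$ for all $x_0,x_{-2}\in\mathcal{H}$ and all $w\in W$. *)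

(* Defs.v *)
From HB Require Import structures.
From mathcomp Require Import all_boot all_order all_algebra.
From mathcomp Require Import sesquilinear complex.
From mathcomp Require Import all_classical all_reals all_analysis.
Set Implicit Arguments.
Unset Strict Implicit.
Unset Printing Implicit Defensive.
Import Order.TTheory GRing.Theory Num.Theory.
Import numFieldNormedType.Exports.
Local Open Scope classical_set_scope.
Local Open Scope ring_scope.
Local Open Scope complex_scope.

Inductive scalar_kind := RealScalars | ComplexScalars.

Section Scalars.
Variable R : realType.

Definition base_field (k : scalar_kind) : numFieldType :=
  match k with
  | RealScalars => (R : numFieldType)
  | ComplexScalars => (R[i] : numFieldType)
  end.

Definition sconj (k : scalar_kind) : base_field k -> base_field k :=
  match k return base_field k -> base_field k with
  | RealScalars => idfun
  | ComplexScalars => fun z : R[i] => z^*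
  end.

Definition sre (k : scalar_kind) : base_field k -> R :=
  match k return base_field k -> R with
  | RealScalars => idfun
  | ComplexScalars => fun z : R[i] => complex.Re z
  end.

(* MathComp norms take their values in the scalar field; [rnorm] is the same
   norm read in [R]. It applies both to vectors and to scalars. *)
Definition rnorm (k : scalar_kind) (V : normedZmodType (base_field k)) (v : V) : R :=
  sre `|v|.

End Scalars.

Section Lambda.
Variables (R : realType) (N r : nat).

Definition offset : R := r%:R / N%:R.

Definition evens (P : set int) : set R := [set 2 * m%:~R | m in P].

Definition shifted_evens (P : set int) : set R :=
  [set 2 * m%:~R + offset | m in P].

Definition Lambda : set R := evens setT `|` shifted_evens setT.

(* The index set [2K]. *)
Definition block (K : nat) : set R :=
  let P := [set m : int | - K%:Z <= m <= K%:Z - 1] in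
  evens P `|` shifted_evens P.

End Lambda.
Arguments evens : clear implicits.
Arguments shifted_evens : clear implicits.
Arguments Lambda : clear implicits.
Arguments block : clear implicits.

Section Hilbert.
Variables (R : realType) (k : scalar_kind).
Local Notation F := (base_field R k).
Variable H : completeNormedModType F.

Definition norm_of_dot (dot : {dot H for @sconj R k}) : Prop :=
  forall x : H, `|x| ^+ 2 = dot x x.

Definition infinite_dimensional : Prop :=
  forall (n : nat) (e : 'I_n -> H),
    ~ (forall x : H, exists c : 'I_n -> F, x = \sum_(i < n) c i *: e i).

Definition separable : Prop := exists S : set H, countable S /\ dense S.

Definition bounded_operator (A : {linear H -> H}) : Prop :=
  exists C : R, forall x : H, rnorm (A x) <= C * rnorm x.

Section Families.
Variables (dot : {dot H for @sconj R k}) (I : choiceType).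

Definition coef_sum (g : I -> H) (f : H) : \bar R :=
  (\esum_(j in [set: I]) (rnorm (dot f (g j)) ^+ 2)%:E)%E.

Definition bessel (beta : R) (g : I -> H) : Prop :=
  forall f : H, (coef_sum g f <= (beta * rnorm f ^+ 2)%:E)%E.

Definition is_frame (g : I -> H) : Prop :=
  exists a b : R, [/\ 0 < a, 0 < b &
    forall f : H, ((a * rnorm f ^+ 2)%:E <= coef_sum g f)%E /\
                  (coef_sum g f <= (b * rnorm f ^+ 2)%:E)%E].

End Families.

Section Matrices.
Variables I J : choiceType.

Definition l2_sum (a : J -> F) : \bar R :=
  (\esum_(j in [set: J]) (rnorm (a j) ^+ 2)%:E)%E.

Definition l2_norm (a : J -> F) : R := Num.sqrt (fine (l2_sum a)).

(* The space B(l^2(J), F^I), as a subset of all matrices. *)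
Definition l2_rows : set (I -> J -> F) :=
  [set T | forall i, (l2_sum (T i) < +oo)%E].

(* Meant for finite [I]. *)
Definition l2_rows_norm (T : I -> J -> F) : R :=
  \sum_(i \in [set: I]) l2_norm (T i).

(* A bounded linear operator on [l2_rows]; the values of [Rec] on the matrices
   outside [l2_rows] are irrelevant. *)
Definition bounded_linear_on_l2_rows (Rec : (I -> J -> F) -> H) : Prop :=
  (forall (c : F) (S T : I -> J -> F), l2_rows S -> l2_rows T ->
     Rec (fun i j => c * S i j + T i j) = c *: Rec S + Rec T) /\
  (exists C : R, forall T : I -> J -> F, l2_rows T ->
     rnorm (Rec T) <= C * l2_rows_norm T).

End Matrices.

Section System.
Variables (N r : nat) (A : {linear H -> H}).
Local Notation q := (offset R N r).

(* The states are indexed by all of [R], but only the values of [x] on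
   [Lambda R N r] are constrained, and only these are ever used. *)
Definition is_state_sequence (x0 xm2 w : H) (x : R -> H) : Prop :=
  [/\ x 0 = x0 /\ x (- 2) = xm2,
      forall l, evens R setT l -> x (l + q) = A (x l) + w,
      forall l, (shifted_evens R N r [set m | 0 < m] `|` [set q]) l ->
        x (l + 2 - q) = A (x l) + w &
      forall l, shifted_evens R N r [set m | m < 0] l ->
        x (l - 2 - q) = A (x l) + w].

Definition measurements (dot : {dot H for @sconj R k}) (K : nat)
    (g : Lambda R N r -> H) (x : R -> H) : block R N r K -> Lambda R N r -> F :=
  fun l j => dot (x (val l)) (g j).

Definition stably_recoverable (dot : {dot H for @sconj R k}) (W : set H)
    (g : Lambda R N r -> H) (K : nat) : Prop :=
  exists Rec : (block R N r K -> Lambda R N r -> F) -> H,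
    bounded_linear_on_l2_rows Rec /\
    forall (x0 xm2 w : H) (x : R -> H), W w ->
      is_state_sequence x0 xm2 w x -> Rec (measurements dot g x) = w.

End System.

End Hilbert.

(* Main.v *)
(** Let t(f) be the l^2 norm of (<f, g_j>)_j.

    If the source is recoverable, the constant states x = f with source
    f - A f give |f - A f| <= C t(f): A nearly fixes f when t(f) is small.
    With source f and zero initial states, the n-th state is
    f + A f + ... + A^(n-1) f, hence within O(t(f)) of n f, and all the
    measurements are O(t(f)); so |f| <= C' t(f), the lower frame bound.

    Conversely, for a frame the analysis operator T f = (<f, g_j>)_j has a
    bounded linear left inverse S, where S a minimizes |a - T f|, and
    w = x_{r/N} - A x_0 is recovered from the rows 0 and r/N.  The minimizer
    exists by completeness and the parallelogram law. *)
Require Import Defs.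
From HB Require Import structures.
From mathcomp Require Import all_boot all_order all_algebra.
From mathcomp Require Import sesquilinear complex.
From mathcomp Require Import all_classical all_reals all_analysis.
From mathcomp Require Import ring lra zify.
Set Implicit Arguments.
Unset Strict Implicit.
Unset Printing Implicit Defensive.
Import Order.TTheory GRing.Theory Num.Theory.
Import numFieldNormedType.Exports.
Local Open Scope classical_set_scope.
Local Open Scope ring_scope.

(** * Real-valued norms over either scalar field *)

Section ScalarNorm.
Variables (R : realType) (k : scalar_kind).
Local Notation F := (base_field R k).

Lemma sreD (x y : F) : sre (x + y) = sre x + sre y.
Proof. by case: k x y => // -[a b] [c d]. Qed.

Lemma sreM_ge0 (x y : F) : 0 <= x -> sre (x * y) = sre x * sre y.
Proof.
case: k x y => // -[a b] [c d] /=.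
by rewrite lecE /= => /andP[/eqP -> _]; rewrite mul0r subr0.
Qed.

Lemma le_sre (x y : F) : x <= y -> sre x <= sre y.
Proof. by case: k x y => // -[a b] [c d] /=; rewrite lecE /= => /andP[]. Qed.

Lemma sre0 : sre (0 : F) = 0.
Proof. by case: k. Qed.

Lemma lt_sre (x y : F) : x < y -> sre x < sre y.
Proof. by case: k x y => // -[a b] [c d] /=; rewrite ltcE /= => /andP[]. Qed.

Lemma sre_surj (e : R) : 0 < e -> exists2 x : F, 0 < x & sre x = e.
Proof.
case: k => /= e0; first by exists e.
by exists (e%:C)%C => //; rewrite ltcE /= eqxx.
Qed.

Lemma lt_of_sre (x y : F) : 0 <= x -> 0 <= y -> sre x < sre y -> x < y.
Proof.
case: k x y => // -[a b] [c d] /=.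
by rewrite !lecE ltcE /= => /andP[/eqP -> _] /andP[/eqP -> _] ->; rewrite eqxx.
Qed.

Lemma sre_eq0 (x : F) : 0 <= x -> sre x = 0 -> x = 0.
Proof.
rewrite le0r => /predU1P[//|x0] sx0.
by have := lt_sre x0; rewrite sre0 sx0 ltxx.
Qed.

Section Vectors.
Variable V : normedZmodType F.
Implicit Types (u v : V).

Lemma rnorm_ge0 v : 0 <= rnorm v.
Proof. by rewrite -sre0; exact: le_sre. Qed.

Lemma rnormD u v : rnorm (u + v) <= rnorm u + rnorm v.
Proof. by rewrite /rnorm -sreD; apply: le_sre; exact: ler_normD. Qed.

Lemma rnormN v : rnorm (- v) = rnorm v.
Proof. by rewrite /rnorm normrN. Qed.

Lemma rnorm_eq0 v : rnorm v = 0 -> v = 0.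
Proof. by move=> v0; apply/normr0_eq0/sre_eq0. Qed.

Lemma rnormMn v n : rnorm (v *+ n) = n%:R * rnorm v.
Proof.
rewrite /rnorm normrMn; elim: n => [|n IHn]; first by rewrite mulr0n sre0 mul0r.
by rewrite mulrS sreD IHn mulrSr mulrDl mul1r addrC.
Qed.

Lemma rnorm0 : rnorm (0 : V) = 0.
Proof. by rewrite /rnorm normr0 sre0. Qed.

End Vectors.

Lemma rnormM (x y : F) : rnorm (x * y) = rnorm x * rnorm y.
Proof. by rewrite /rnorm normrM sreM_ge0. Qed.

Lemma rnorm_nat n : rnorm (n%:R : F) = n%:R.
Proof. by rewrite rnormMn /rnorm normr1; case: k => /=; rewrite mulr1. Qed.

(** Both sides equal twice the sum of the three squares plus the cross terms. As all terms are
    nonnegative, the identity can be summed over any index set, and it stands in for the bilinearity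
    of an inner product. *)
Lemma rnorm_three_term (x y z : F) :
  rnorm (x + y + z) ^+ 2 + rnorm x ^+ 2 + rnorm y ^+ 2 + rnorm z ^+ 2 =
  rnorm (x + y) ^+ 2 + rnorm (y + z) ^+ 2 + rnorm (x + z) ^+ 2.
Proof.
case: k x y z => [x y z|[a b] [c d] [e f]] /=.
  by rewrite /rnorm/= !real_normK ?num_real//; ring.
rewrite /rnorm/= !sqr_sqrtr ?addr_ge0 ?sqr_ge0//=; ring.
Qed.

End ScalarNorm.

(** * Square-summable families and their squared norm *)

Section SquareSummable.
Variables (R : realType) (k : scalar_kind) (J : choiceType).
Local Notation F := (base_field R k).
Implicit Types (a b x y z : J -> F).

Definition l2 a : Prop := (l2_sum a < +oo)%E.

Definition l2sq a : R := fine (l2_sum a).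

Lemma l2_sum_ge0 a : (0 <= l2_sum a)%E.
Proof. by apply: esum_ge0 => j _; rewrite lee_fin sqr_ge0. Qed.

Lemma l2sq_ge0 a : 0 <= l2sq a.
Proof. exact/fine_ge0/l2_sum_ge0. Qed.

Lemma l2sqK a : l2 a -> l2_sum a = (l2sq a)%:E.
Proof. by move=> la; rewrite fineK// ge0_fin_numE// l2_sum_ge0. Qed.

Lemma l2_sum_three_term x y z :
  (l2_sum (x + y + z)%R + l2_sum x + l2_sum y + l2_sum z =
   l2_sum (x + y)%R + l2_sum (y + z)%R + l2_sum (x + z)%R)%E.
Proof.
rewrite -!esumD//; do ?[by move=> *; rewrite ?adde_ge0// lee_fin sqr_ge0].
by apply: eq_esum => j _; rewrite -!EFinD -rnorm_three_term.
Qed.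

(** Finite partial sums scale exactly; the supremum then gives one inequality, and [l2sqZ] recovers
    equality. *)
Lemma l2_sumZ_le (c : F) a : (l2_sum (c *: a)%R <= (rnorm c ^+ 2)%:E * l2_sum a)%E.
Proof.
apply: ub_ereal_sup => _ [X XJ <-].
rewrite [leLHS](_ : _ = (rnorm c ^+ 2)%:E * \sum_(j \in X) (rnorm (a j) ^+ 2)%:E)%E.
  rewrite lee_wpmul2l ?lee_fin ?sqr_ge0//.
  by apply: esum_ge; exists X.
rewrite ge0_mule_fsumr; last by move=> j; rewrite lee_fin sqr_ge0.
by apply: eq_fsbigr => j _; rewrite -EFinM -exprMn -rnormM.
Qed.

Lemma l2_sumN a : l2_sum (- a) = l2_sum a.
Proof. by apply: eq_esum => j _; rewrite rnormN. Qed.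

Lemma l2_sum0 : l2_sum (0 : J -> F) = 0%E.
Proof. by apply: esum1 => j _; rewrite rnorm0 expr0n. Qed.

Lemma l2Z (c : F) a : l2 a -> l2 (c *: a).
Proof.
move=> la; apply: le_lt_trans (l2_sumZ_le c a) _.
by rewrite (l2sqK la) -EFinM ltry.
Qed.

Lemma l2N a : l2 a -> l2 (- a).
Proof. by rewrite /l2 l2_sumN. Qed.

Lemma l2_0 : l2 (0 : J -> F).
Proof. by rewrite /l2 l2_sum0 ltry. Qed.

Lemma l2sqN a : l2sq (- a) = l2sq a.
Proof. by rewrite /l2sq l2_sumN. Qed.

Lemma l2sq0 : l2sq (0 : J -> F) = 0.
Proof. by rewrite /l2sq l2_sum0. Qed.

(** With third term [- y], the three-term identity becomes the parallelogram law in the extended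
    reals, which bounds the sum before its finiteness is known. *)
Lemma l2D x y : l2 x -> l2 y -> l2 (x + y).
Proof.
move=> lx ly; have := l2_sum_three_term x y (- y).
rewrite addrK subrr l2_sumN l2_sum0 (l2sqK lx) (l2sqK ly) adde0 -!EFinD => E.
rewrite /l2 (@le_lt_trans _ _ (l2_sum (x + y)%R + l2_sum (x - y)%R)%E)//.
  by rewrite leeDl// l2_sum_ge0.
by rewrite -E ltry.
Qed.

Lemma l2B x y : l2 x -> l2 y -> l2 (x - y).
Proof. by move=> lx ly; apply: l2D => //; exact: l2N. Qed.

Lemma l2Mn x n : l2 x -> l2 (x *+ n).
Proof.
by move=> lx; elim: n => [|n IH]; [exact: l2_0|rewrite mulrSr; exact: l2D].
Qed.

Lemma l2sq_three_term x y z : l2 x -> l2 y -> l2 z ->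
  l2sq (x + y + z) + l2sq x + l2sq y + l2sq z =
  l2sq (x + y) + l2sq (y + z) + l2sq (x + z).
Proof.
move=> lx ly lz; have := l2_sum_three_term x y z.
have lxy := l2D lx ly; have lyz := l2D ly lz; have lxz := l2D lx lz.
have lxyz := l2D lxy lz.
by rewrite !l2sqK// -!EFinD => -[].
Qed.

Lemma l2sq_parallelogram x y : l2 x -> l2 y ->
  l2sq (x + y) + l2sq (x - y) = 2 * l2sq x + 2 * l2sq y.
Proof.
move=> lx ly; have := l2sq_three_term lx ly (l2N ly).
rewrite addrK subrr l2sqN l2sq0; lra.
Qed.

Lemma l2sqZ (c : F) a : l2 a -> l2sq (c *: a) = rnorm c ^+ 2 * l2sq a.
Proof.
have le c' b : l2 b -> l2sq (c' *: b) <= rnorm c' ^+ 2 * l2sq b.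
  move=> lb; rewrite -lee_fin EFinM -!l2sqK//; last exact: l2Z.
  exact: l2_sumZ_le.
move=> la; have [->|c0] := eqVneq c 0.
  by rewrite scale0r rnorm0 expr0n mul0r l2sq0.
apply/eqP; rewrite eq_le le//=.
(* The reverse inequality is the same bound for [c^-1] applied to [c *: a]. *)
have := le c^-1 _ (l2Z c la); rewrite scalerA mulVf// scale1r => h.
have := ler_wpM2l (sqr_ge0 (rnorm c)) h.
by rewrite mulrA -exprMn -rnormM mulfV// (rnorm_nat _ _ 1) expr1n mul1r.
Qed.

Lemma l2sqMn a n : l2 a -> l2sq (a *+ n) = n%:R ^+ 2 * l2sq a.
Proof.
move=> la; rewrite -[n%:R](rnorm_nat R k) -l2sqZ//.
by rewrite scaler_nat.
Qed.

End SquareSummable.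

(** * Least squares: a left inverse of a map bounded above and below *)

Section LeastSquares.
Variables (R : realType) (k : scalar_kind) (J : choiceType).
Local Notation F := (base_field R k).
Variables (H : completeNormedModType F) (T : {linear H -> (J -> F)}).
Variables (alpha beta : R) (alpha0 : 0 < alpha).
Hypothesis T_l2 : forall h, l2 (T h).
Hypothesis T_le : forall h, l2sq (T h) <= beta * rnorm h ^+ 2.
Hypothesis T_ge : forall h, alpha * rnorm h ^+ 2 <= l2sq (T h).
Implicit Types (a b : J -> F) (f h : H).

Lemma map_scale_natinv n h : T (n.+1%:R^-1 *: h) *+ n.+1 = T h.
Proof. by rewrite -raddfMn -scaler_nat scalerA mulfV ?scale1r// pnatr_eq0. Qed.

(* Pythagoras instead of an inner product: it only involves sums of
   nonnegative terms, and is equivalent to orthogonality since the range is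
   a subspace. *)
Definition orthogonal_to_range b :=
  forall h, l2sq (b + T h) = l2sq b + l2sq (T h).

Lemma l2sq_map_eq0 h : l2sq (T h) = 0 -> h = 0.
Proof.
move=> Th; apply: rnorm_eq0; apply/eqP; rewrite -sqrf_eq0 eq_le sqr_ge0 andbT.
by have := T_ge h; rewrite Th pmulr_rle0.
Qed.

(** On square-summable families this is twice the real part of the inner product of [b] and [v]. *)
Definition polar b v : R := l2sq (b + v) - l2sq b - l2sq v.

(** Induction on [n], with the three-term identity for [b *+ n], [b] and [v]. *)
Lemma polarMn b v n : l2 b -> l2 v -> polar (b *+ n) v = n%:R * polar b v.
Proof.
move=> lb lv; rewrite /polar; elim: n => [|n IH].
  by rewrite !mulr0n add0r l2sq0 mul0r; ring.
have := l2sq_three_term (l2Mn n lb) lb lv; rewrite -!mulrSr !l2sqMn// => E.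
have {}E : l2sq (b *+ n.+1 + v) =
    n.+1%:R ^+ 2 * l2sq b + l2sq (b + v) + l2sq (b *+ n + v)
   - n%:R ^+ 2 * l2sq b - l2sq b - l2sq v by lra.
rewrite E mulrSr; move: IH; rewrite l2sqMn// => IH.
have -> : l2sq (b *+ n + v) =
    n%:R * (l2sq (b + v) - l2sq b - l2sq v) + n%:R ^+ 2 * l2sq b + l2sq v by lra.
ring.
Qed.

Lemma ge0_of_natmul_bound (p d : R) : (forall n, 0 <= n%:R * p + d) -> 0 <= p.
Proof.
move=> h; rewrite leNgt; apply/negP => p0.
have [n hn] : exists n : nat, d / - p < n%:R.
  exists (Num.bound `|d / - p|).
  exact: le_lt_trans (ler_norm _) (archi_boundP (normr_ge0 _)).
move: hn; rewrite ltr_pdivrMr ?oppr_gt0// => hn.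
by have := h n; rewrite leNgt => /negP; apply; lra.
Qed.

(* Minimality along [T h / n] reads [0 <= n * polar b (T h) + l2sq (T h)], and
   [polar] is odd in [h]. *)
Lemma least_orthogonal b : l2 b -> (forall h, l2sq b <= l2sq (b + T h)) ->
  orthogonal_to_range b.
Proof.
move=> lb min.
have polar_ge0 h : 0 <= polar b (T h).
  apply: (@ge0_of_natmul_bound _ (l2sq (T h))) => n; rewrite -polarMn// /polar.
  rewrite l2sqMn//; case: n => [|n].
    by rewrite mulr0n add0r; have := l2sq_ge0 (T h); lra.
  have -> : b *+ n.+1 + T h = (b + T (n.+1%:R^-1 *: h)) *+ n.+1.
    by rewrite mulrnDl map_scale_natinv.
  rewrite l2sqMn; last exact: l2D.
  have := ler_wpM2l (sqr_ge0 (n.+1%:R : R)) (min (n.+1%:R^-1 *: h)).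
  lra.
move=> h; have := polar_ge0 h; have := polar_ge0 (- h).
have := l2sq_parallelogram lb (T_l2 h).
rewrite /polar raddfN l2sqN; lra.
Qed.

(** Completeness of [H] uses balls with radii in the scalar field; [lt_of_sre] and [sre_surj]
    translate them to real radii. *)
Lemma cauchy_seq_limit (u : nat -> H) :
  (forall e : R, 0 < e -> exists n, forall i j, (n <= i)%N -> (n <= j)%N ->
     rnorm (u i - u j) < e) ->
  exists l, forall e : R, 0 < e ->
    exists n, forall i, (n <= i)%N -> rnorm (u i - l) < e.
Proof.
move=> uC.
have : cauchy (u @ \oo).
  apply/cauchy_ballP => e e0.
  have /uC[n hn] : 0 < sre e by rewrite -(sre0 R k); exact: lt_sre.
  exists (u @` [set i | (n <= i)%N], u @` [set i | (n <= i)%N]).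
    by split; exists n => //= i ni; exists i.
  case=> _ _ /= [[i ni <-] [j nj <-]].
  rewrite -ball_normE /=; apply: lt_of_sre (hn _ _ ni nj) => //; exact: ltW.
move=> /cauchy_cvg /cvg_ex[l ul]; exists l => e e0.
have [x x0 <-] := sre_surj k e0.
move/cvgrPdist_lt: ul => /(_ _ x0) [n _ hn]; exists n => i ni.
by rewrite -rnormN opprB; have := hn i ni; rewrite /rnorm /=; exact: lt_sre.
Qed.

(** A minimizing sequence is Cauchy by the parallelogram law and [T_ge]; its limit attains the
    infimum by [T_le]. *)
Lemma least_squares_exists a : l2 a ->
  exists f, forall h, l2sq (a - T f) <= l2sq (a - T h).
Proof.
move=> la.
pose Q h := l2sq (a - T h).
pose d := inf (range Q).
have lQ h : l2 (a - T h) by exact: l2B.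
have lbQ : has_lbound (range Q) by exists 0 => _ [h _ <-]; exact: l2sq_ge0.
have infQ : has_inf (range Q) by split => //; exists (Q 0), 0.
have dle h : d <= Q h by apply: ge_inf => //; exists h.
have /choice[u hu] : forall n : nat, exists h, Q h < d + n.+1%:R^-1.
  move=> n; have n0 : 0 < n.+1%:R^-1 :> R by rewrite invr_gt0 ltr0n.
  by have [_ [h _ <-] hh] := inf_adherent n0 infQ; exists h.
(* Parallelogram law for [a - T f] and [a - T h]: their sum is twice the residual at the midpoint,
   where [Q] is at least [d]. *)
have gap f h : alpha * rnorm (f - h) ^+ 2 <= 2 * (Q f - d) + 2 * (Q h - d).
  apply: le_trans (T_ge _) _.
  have := l2sq_parallelogram (lQ h) (lQ f).
  rewrite (_ : a - T h - (a - T f) = T (f - h)); last first.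
    by rewrite (raddfB T) opprB addrC addrA subrK.
  rewrite (_ : a - T h + (a - T f) = (a - T (2^-1 *: (f + h))) *+ 2); last first.
    by rewrite mulrnBl map_scale_natinv (raddfD T) mulr2n opprD addrACA (addrC (- T h)).
  rewrite l2sqMn//; have := dle (2^-1 *: (f + h)); rewrite /Q; lra.
have small e : 0 < e -> exists n : nat, forall i, (n <= i)%N -> Q (u i) - d < e.
  move=> e0; exists (Num.bound e^-1) => i ni.
  rewrite ltrBlDl; apply: lt_le_trans (hu i) _; rewrite lerD2l.
  rewrite -[e]invrK lef_pV2 ?posrE ?invr_gt0 ?ltr0n//.
  have e1 : 0 <= e^-1 by rewrite invr_ge0 ltW.
  apply: le_trans (ltW (archi_boundP e1)) _; rewrite ler_nat; exact: leqW.
have [l hl] : exists l, forall e : R, 0 < e ->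
    exists n, forall i, (n <= i)%N -> rnorm (u i - l) < e.
  apply: cauchy_seq_limit => e e0.
  have e1 : 0 < alpha * e ^+ 2 / 4 by rewrite divr_gt0// mulr_gt0// exprn_gt0.
  have [n hn] := small _ e1; exists n => i j ni nj.
  rewrite -(@ltr_pXn2r _ 2) ?nnegrE ?rnorm_ge0 ?ltW// -(ltr_pM2l alpha0).
  have := gap (u i) (u j); have := hn i ni; have := hn j nj; lra.
exists l => h; apply: le_trans (dle h); apply/ler_addgt0Pl => e e0.
(* Parallelogram law for [a - T (u i)] and [T (u i - l)]: the sum is the residual at [l], the
   difference is the residual at the reflection of [l] in [u i], where [Q] is again at least [d]. *)
have Ql i : Q l <= d + 2 * (Q (u i) - d) + 2 * beta * rnorm (u i - l) ^+ 2.
  have := l2sq_parallelogram (lQ (u i)) (T_l2 (u i - l)).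
  have -> : a - T (u i) + T (u i - l) = a - T l by rewrite (raddfB T) addrA subrK.
  have -> : a - T (u i) - T (u i - l) = a - T (u i + (u i - l)).
    by rewrite -addrA -opprD -(raddfD T).
  have := dle (u i + (u i - l)); have := T_le (u i - l); rewrite /Q; lra.
(* Each of the last two terms of [Ql] is to contribute at most [e / 2]. Using [|beta| + 1] keeps the
   denominator positive. *)
have [n hn] := small _ (divr_gt0 e0 (ltr0n _ 4)).
have e1 : 0 < e / (4 * (`|beta| + 1)) by rewrite divr_gt0// mulr_gt0// ltr_wpDl.
have [m hm] := hl (Num.sqrt (e / (4 * (`|beta| + 1)))) ltac:(by rewrite sqrtr_gt0).
have := Ql (maxn n m); have := hn _ (leq_maxl n m); have := hm _ (leq_maxr n m).
set t := rnorm _ => ht hq hQ.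
have : t ^+ 2 < e / (4 * (`|beta| + 1)).
  rewrite -(sqr_sqrtr (ltW e1)) ltr_pXn2r ?nnegrE ?rnorm_ge0 ?sqrtr_ge0//.
rewrite ltr_pdivlMr ?mulr_gt0 ?ltr_wpDl// => ht2.
have : beta * t ^+ 2 <= (`|beta| + 1) * t ^+ 2.
  by rewrite ler_wpM2r ?sqr_ge0// (le_trans (ler_norm _))// lerDl.
rewrite -/(Q l); lra.
Qed.

Lemma orthogonal_projection_exists a : l2 a ->
  exists f, orthogonal_to_range (a - T f).
Proof.
move=> la; have [f hf] := least_squares_exists la; exists f.
apply: least_orthogonal; first exact: l2B.
move=> h; have -> // : a - T f + T h = a - T (f - h).
by rewrite (raddfB T) opprB addrA addrAC.
Qed.

(** Pythagoras from each residual to the other; adding the two equations leaves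
    [l2sq (T (f - f')) = 0]. *)
Lemma orthogonal_projection_unique a f f' :
  orthogonal_to_range (a - T f) -> orthogonal_to_range (a - T f') -> f = f'.
Proof.
move=> /(_ (f - f')) + /(_ (f' - f)).
have E p q : a - T p + T (p - q) = a - T q by rewrite (raddfB T) addrA subrK.
rewrite !E -(opprB f f') (raddfN T) l2sqN => h1 h2.
apply/eqP; rewrite -subr_eq0; apply/eqP/l2sq_map_eq0; lra.
Qed.

Lemma orthogonalD b b' : l2 b -> l2 b' ->
  orthogonal_to_range b -> orthogonal_to_range b' -> orthogonal_to_range (b + b').
Proof.
move=> lb lb' ob ob' h; have := l2sq_three_term lb lb' (T_l2 h).
rewrite ob ob'; lra.
Qed.

Lemma orthogonalZ (c : F) b : l2 b ->
  orthogonal_to_range b -> orthogonal_to_range (c *: b).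
Proof.
move=> lb ob h; have [->|c0] := eqVneq c 0; first by rewrite scale0r add0r l2sq0 add0r.
have {1 2}-> : h = c *: (c^-1 *: h) by rewrite scalerA mulfV ?scale1r.
rewrite (linearZ_LR T)/= -scalerDr !l2sqZ//; last exact: l2D.
by rewrite ob mulrDr.
Qed.

(** Selected by orthogonality rather than minimality, because orthogonality is visibly stable under
    linear combinations. The default [0] concerns families without a projection. *)
Definition least_squares a : H := xget 0 [set f | orthogonal_to_range (a - T f)].

Lemma least_squaresP a : l2 a -> orthogonal_to_range (a - T (least_squares a)).
Proof.
move=> /orthogonal_projection_exists[f orth_f].
by rewrite /least_squares; case: xgetP => // /(_ f).
Qed.

Lemma least_squaresE a f : orthogonal_to_range (a - T f) -> least_squares a = f.
Proof.
move=> orth_f; apply: (@orthogonal_projection_unique a) => //.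
by rewrite /least_squares; case: xgetP => // /(_ f).
Qed.

Lemma least_squares_linear (c : F) a b : l2 a -> l2 b ->
  least_squares (c *: a + b) = c *: least_squares a + least_squares b.
Proof.
move=> la lb; apply: least_squaresE.
rewrite (linearP T) opprD addrACA -scalerBr.
by apply: orthogonalD; [apply: l2Z| |apply: orthogonalZ|];
   do ?[exact: l2B|exact: least_squaresP].
Qed.

Lemma least_squares_range f : least_squares (T f) = f.
Proof.
by apply: least_squaresE => h; rewrite subrr add0r l2sq0 add0r.
Qed.

(** By Pythagoras [a] splits into its residual and [T (least_squares a)], so the latter has the
    smaller norm. *)
Lemma least_squares_bound a : l2 a ->
  alpha * rnorm (least_squares a) ^+ 2 <= l2sq a.
Proof.
move=> la; apply: le_trans (T_ge _) _.
have := least_squaresP la (least_squares a); rewrite subrK => ->.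
by rewrite lerDr l2sq_ge0.
Qed.

End LeastSquares.

(** * Norms of matrices with finitely many rows *)

Section FiniteRows.
Variables (R : realType) (k : scalar_kind) (I J : choiceType).
Local Notation F := (base_field R k).
Hypothesis finI : finite_set [set: I].
Implicit Type M : I -> J -> F.

Lemma l2_norm_ge0 (a : J -> F) : 0 <= l2_norm a.
Proof. exact: sqrtr_ge0. Qed.

Lemma l2_norm_sqr (a : J -> F) : l2_norm a ^+ 2 = l2sq a.
Proof. by rewrite sqr_sqrtr// l2sq_ge0. Qed.

Lemma l2_norm_le_rows M i : l2_norm (M i) <= l2_rows_norm M.
Proof.
rewrite /l2_rows_norm (fsbigD1 i)//= lerDl.
by apply: fsumr_ge0 => j _; exact: l2_norm_ge0.
Qed.

Lemma l2_rows_norm_le M (c : I -> R) t :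
  (forall i, l2_norm (M i) <= c i * t) ->
  l2_rows_norm M <= (\sum_(i \in [set: I]) c i) * t.
Proof.
move=> Mc; rewrite /l2_rows_norm !fsbig_finite//= mulr_suml.
by apply: ler_sum => i _.
Qed.

End FiniteRows.

(** * Finiteness of the blocks, and trajectories built from a one-sided recursion *)

Section Trajectories.
Variables (R : realType) (N r : nat).
Local Notation q := (offset R N r).

Lemma finite_block K : finite_set [set: block R N r K].
Proof.
have finP : finite_set [set m : int | - K%:Z <= m <= K%:Z - 1].
  apply: (@sub_finite_set _ _ ((fun n : nat => n%:Z - K%:Z) @` `I_(2 * K))).
    move=> m /= /andP[m1 m2]; exists (absz (m + K%:Z)); lia.
  exact/finite_image/finite_II.
have -> : [set: block R N r K] = val @^-1` (block R N r K).
  by apply/seteqP; split => // x _; exact: set_mem (valP x).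
apply: finite_preimage; first by move=> x y _ _; exact: val_inj.
by rewrite finite_setU; split; exact: finite_image.
Qed.

Hypothesis hN : (1 <= N)%N.
Hypothesis hr : (1 <= r <= 2 * N - 1)%N.

Lemma offset_gt0 : 0 < q.
Proof. by case/andP: hr => r1 _; rewrite divr_gt0 ?ltr0n. Qed.

Lemma offset_lt2 : q < 2.
Proof.
case/andP: hr => _ r2; rewrite ltr_pdivrMr ?ltr0n// -natrM ltr_nat.
by apply: leq_ltn_trans r2 _; rewrite subn1 prednK// muln_gt0.
Qed.

(** Number of double steps leading to [2 m], from [0] if [m] is nonnegative and from [-2] otherwise;
    hence [0] and [-1] both have count zero. *)
Definition step_count (m : int) : nat := if 0 <= m then absz m else absz (m + 1).

Lemma step_count_ge0 (m : int) : 0 <= m -> step_count (m + 1) = (step_count m).+1.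
Proof. by move=> m0; rewrite /step_count m0 ifT; lia. Qed.

Lemma step_count_lt0 (m : int) : m < 0 -> step_count (m - 1) = (step_count m).+1.
Proof. by move=> m0; rewrite /step_count !ifF; lia. Qed.

(* The two half-lines started at [0] and at [-2] carry the same recursion;
   [half_line_time l] is the number of its steps leading to [x_l]. *)
Definition half_line_time (l : R) : nat :=
  let m := Num.floor (l / 2) in ((step_count m).*2 + (l != 2 * m%:~R)%R)%N.

Lemma time_even (m : int) : half_line_time (2 * m%:~R) = (step_count m).*2.
Proof.
by rewrite /half_line_time mulrAC mulfV// mul1r intrKfloor eqxx addn0.
Qed.

(** Since the offset lies strictly between 0 and 2, halving and taking the floor returns [m], and
    the point differs from [2 m], which adds the odd step. *)
Lemma time_shifted (m : int) : half_line_time (2 * m%:~R + q) = (step_count m).*2.+1.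
Proof.
have q0 := offset_gt0; have q2 := offset_lt2.
have -> : half_line_time (2 * m%:~R + q) =
    ((step_count m).*2 + (2 * m%:~R + q != 2 * m%:~R :> R)%R)%N.
  rewrite /half_line_time (_ : Num.floor _ = m)//.
  apply: floor_def; rewrite intrD1; lra.
by rewrite -subr_eq0 addrAC subrr add0r gt_eqF// addn1.
Qed.

Section States.
Variables (k : scalar_kind) (H : completeNormedModType (base_field R k)).
Variables (A : {linear H -> H}) (w : H) (y : nat -> H).
Hypothesis yS : forall n, y n.+1 = A (y n) + w.

(** Each of the three rules of the system advances [half_line_time] by exactly one, so it reduces to
    [yS]. *)
Lemma is_state_sequence_half_line :
  is_state_sequence N r A (y 0) (y 0) w (y \o half_line_time).
Proof.
have te := time_even; have ts := time_shifted.
split => /=.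
- split; first by have := te 0; rewrite mulr0 => ->.
  by have := te (- 1); rewrite (_ : 2 * _ = - 2) => [->//|]; rewrite mulrN1.
- by move=> _ [m _ <-]; rewrite ts te yS.
(* The case [m = 0] is the isolated point [q] of the second rule. *)
- have pos m : 0 <= m ->
      y (half_line_time (2 * m%:~R + q + 2 - q)) =
      A (y (half_line_time (2 * m%:~R + q))) + w.
    move=> m0; rewrite -yS ts (_ : _ - q = 2 * (m + 1)%:~R);
      last by rewrite intrD1; ring.
    by rewrite te step_count_ge0// doubleS.
  move=> _ [[m /= m0 <-]|->]; first by apply: pos; exact: ltW.
  by have := pos 0 (lexx _); rewrite mulr0 add0r.
- move=> _ [m /= m0 <-].
  rewrite -yS ts (_ : _ - q = 2 * (m - 1)%:~R); last by rewrite intrB; ring.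
  by rewrite te step_count_lt0// doubleS.
Qed.

End States.
End Trajectories.

(** * The analysis operator and the two implications *)

Section Recovery.
Variables (R : realType) (k : scalar_kind).
Local Notation F := (base_field R k).
Variables (H : completeNormedModType F) (dot : {dot H for @sconj R k}).

Section Analysis.
Variables (J : choiceType) (g : J -> H) (beta : R).
Hypothesis hbessel : bessel dot beta g.

Definition analysis (f : H) : J -> F := fun j => dot f (g j).

Lemma analysis_is_linear : linear analysis.
Proof. by move=> c u v; apply/funext => j; rewrite /analysis linearPl. Qed.

HB.instance Definition _ :=
  @GRing.isLinear.Build F H (J -> F) *:%R analysis analysis_is_linear.

Lemma analysis_l2 f : l2 (analysis f).
Proof. by apply: le_lt_trans (hbessel f) _; rewrite ltry. Qed.

Lemma analysis_le f : l2sq (analysis f) <= beta * rnorm f ^+ 2.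
Proof. by rewrite -lee_fin -l2sqK; [exact: hbessel|exact: analysis_l2]. Qed.

(** The Bessel bound serves as upper frame bound, so only the lower one remains at stake. *)
Lemma is_frameP : 0 < beta ->
  is_frame dot g <->
  exists2 alpha, 0 < alpha & forall f, alpha * rnorm f ^+ 2 <= l2sq (analysis f).
Proof.
move=> beta0; split=> [[a [b [a0 _ hab]]]|[a a0 ha]].
  exists a => // f; rewrite -lee_fin -l2sqK; last exact: analysis_l2.
  by case: (hab f).
exists a, beta; split=> // f; split; last exact: hbessel.
by have := ha f; rewrite -lee_fin -l2sqK//; exact: analysis_l2.
Qed.

End Analysis.

Lemma bounded_operator_ge0 (A : {linear H -> H}) : bounded_operator A ->
  exists2 C : R, 0 <= C & forall x : H, rnorm (A x) <= C * rnorm x.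
Proof.
move=> [C hC]; exists `|C| => // x; apply: le_trans (hC x) _.
by rewrite ler_wpM2r ?rnorm_ge0 ?ler_norm.
Qed.

Variables (N r : nat).
Hypothesis hN : (1 <= N)%N.
Hypothesis hr : (1 <= r <= 2 * N - 1)%N.
Variables (A : {linear H -> H}) (hA : bounded_operator A).
Variables (g : Lambda R N r -> H) (beta : R).
Hypothesis beta0 : 0 < beta.
Hypothesis hbessel : bessel dot beta g.

Lemma frame_recoverable : is_frame dot g -> stably_recoverable A dot [set: H] g 1.
Proof.
move=> /(is_frameP hbessel beta0)[alpha alpha0 ha].
have [CA CA0 hCA] := bounded_operator_ge0 hA.
(* Both measured points come from [m = 0], which belongs to the range already for [K = 1]. *)
have b0 : block R N r 1 0 by left; exists 0 => //; rewrite mulr0.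
have bq : block R N r 1 (offset R N r) by right; exists 0 => //; rewrite mulr0 add0r.
pose i0 : block R N r 1 := SigSub (mem_set b0).
pose iq : block R N r 1 := SigSub (mem_set bq).
pose S := least_squares (analysis g).
have Slin c a b : l2 a -> l2 b -> S (c *: a + b) = c *: S a + S b.
  exact: (least_squares_linear alpha0 (analysis_l2 hbessel) (analysis_le hbessel) ha).
have Sbound a : l2 a -> rnorm (S a) <= Num.sqrt alpha^-1 * l2_norm a.
  move=> la.
  rewrite -(@ler_pXn2r _ 2)// ?nnegrE ?rnorm_ge0 ?mulr_ge0 ?l2_norm_ge0 ?sqrtr_ge0//.
  rewrite exprMn l2_norm_sqr sqr_sqrtr; last by rewrite invr_ge0 ltW.
  rewrite ler_pdivlMl//.
  exact: (least_squares_bound alpha0 (analysis_l2 hbessel) (analysis_le hbessel) ha).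
exists (fun M => S (M iq) - A (S (M i0))); split; last first.
  move=> x0 xm2 w x _ [_ xq _ _].
  have SE i : S (measurements dot g x i) = x (val i).
    exact: (least_squares_range alpha0 ha).
  have := xq 0; rewrite !SE /= add0r => ->; first by rewrite addrC addKr.
  by exists 0 => //; rewrite mulr0.
split=> [c M M' lM lM'|].
  rewrite -[LHS]/(S (c *: M iq + M' iq) - A (S (c *: M i0 + M' i0))).
  rewrite (Slin c _ _ (lM iq) (lM' iq)) (Slin c _ _ (lM i0) (lM' i0)).
  by rewrite linearP scalerBr opprD addrACA.
exists ((1 + CA) * Num.sqrt alpha^-1) => M lM.
have row_le i := l2_norm_le_rows (finite_block R N r 1) M i.
apply: le_trans (rnormD _ _) _; rewrite rnormN -mulrA mulrDl mul1r lerD//.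
  exact: le_trans (Sbound _ (lM _)) (ler_wpM2l (sqrtr_ge0 _) (row_le _)).
apply: le_trans (hCA _) _; rewrite ler_wpM2l//.
exact: le_trans (Sbound _ (lM _)) (ler_wpM2l (sqrtr_ge0 _) (row_le _)).
Qed.

(** The finitely many rows are each bounded by some [c n * t], so summing [c] over the block gives a
    constant independent of [y], [w] and [t]. *)
Lemma recoverable_bound K (c : nat -> R) :
  stably_recoverable A dot [set: H] g K ->
  exists2 C, 0 <= C & forall (y : nat -> H) (w : H) (t : R), 0 <= t ->
    (forall n, y n.+1 = A (y n) + w) ->
    (forall n, l2_norm (analysis g (y n)) <= c n * t) -> rnorm w <= C * t.
Proof.
move=> [Rec [[_ [C hC]] hRec]].
pose s := \sum_(i \in [set: block R N r K]) c (half_line_time (val i)).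
exists (`|C| * `|s|) => [|y w t t0 yS yc]; first exact: mulr_ge0.
have st := is_state_sequence_half_line hN hr yS.
rewrite -(hRec _ _ _ _ I st); set M := measurements _ _ _.
apply: le_trans (hC M _) _; first by move=> i; exact: (analysis_l2 hbessel).
have M0 : 0 <= l2_rows_norm M by apply: fsumr_ge0 => i _; exact: l2_norm_ge0.
rewrite -mulrA; apply: le_trans (ler_wpM2r M0 (ler_norm C)) _.
rewrite ler_wpM2l//; apply: (@le_trans _ _ (s * t));
  last by rewrite ler_wpM2r// ler_norm.
by apply: l2_rows_norm_le => [|i]; [exact: finite_block|exact: yc].
Qed.

Lemma recoverable_frame K : stably_recoverable A dot [set: H] g K -> is_frame dot g.
Proof.
move=> hrec; apply/(is_frameP hbessel beta0).
have [CA CA0 hCA] := bounded_operator_ge0 hA.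
pose t f := l2_norm (analysis g f).
have t0 f : 0 <= t f by exact: l2_norm_ge0.
(* Constant states: [x = f] and [w = f - A f]. *)
have [C1 C1_ge0 near_fixed] : exists2 C, 0 <= C & forall f, rnorm (f - A f) <= C * t f.
  have [C C0 hC] := recoverable_bound (fun=> 1) hrec.
  exists C => // f; apply: (hC (fun=> f)) => // n; first by rewrite addrC subrK.
  by rewrite mul1r.
(* States started at [0] with [w = f]: they stay close to the multiples of [f]. *)
pose y f n := iter n (fun v => A v + f) 0.
have /choice[e he] : forall n, exists e, forall f, rnorm (y f n - f *+ n) <= e * t f.
  elim=> [|n [e IH]]; first by exists 0 => f; rewrite subrr rnorm0 mul0r.
  exists (CA * e + n%:R * C1) => f.
  (* The error from [n f] is propagated by [A], with [n] copies of the defect [f - A f] added at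
     each step; this gives the recursion for [e]. *)
  have -> : y f n.+1 - f *+ n.+1 = A (y f n - f *+ n) - (f - A f) *+ n.
    rewrite (raddfB A) (raddfMn A) mulrnBl opprB addrA subrK mulrSr opprD.
    by rewrite addrACA subrr addr0.
  apply: le_trans (rnormD _ _) _; rewrite rnormN rnormMn mulrDl -!mulrA lerD//.
    by apply: le_trans (hCA _) _; rewrite ler_wpM2l.
  by rewrite ler_wpM2l.
(* From the parallelogram law applied to the images of [n f] and [y f n - n f] under
   [analysis g]. *)
pose c n := Num.sqrt (2 * n%:R ^+ 2 + 2 * beta * e n ^+ 2).
have [C C0 hC] := recoverable_bound c hrec.
have {}hC f : rnorm f <= C * t f.
  apply: (hC (y f)) => // n; have lT := analysis_l2 hbessel.
  have c0 : 0 <= 2 * n%:R ^+ 2 + 2 * beta * e n ^+ 2.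
    have := sqr_ge0 (n%:R : R); have := mulr_ge0 (ltW beta0) (sqr_ge0 (e n)); lra.
  rewrite -(@ler_pXn2r _ 2)// ?nnegrE ?l2_norm_ge0 ?mulr_ge0 ?sqrtr_ge0//.
  rewrite exprMn /t !l2_norm_sqr sqr_sqrtr//.
  have := l2sq_parallelogram (l2Mn n (lT f)) (lT (y f n - f *+ n)).
  rewrite l2sqMn//.
  have -> : analysis g f *+ n + analysis g (y f n - f *+ n) = analysis g (y f n).
    by rewrite -(raddfMn (analysis g)) -(raddfD (analysis g)) addrC subrK.
  have := l2sq_ge0 (analysis g f *+ n - analysis g (y f n - f *+ n)).
  have : rnorm (y f n - f *+ n) ^+ 2 <= e n ^+ 2 * l2sq (analysis g f).
    rewrite -l2_norm_sqr -exprMn ler_pXn2r ?nnegrE ?rnorm_ge0//.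
    exact: le_trans (rnorm_ge0 _) (he n f).
  move=> /(ler_wpM2l (ltW beta0)).
  have := analysis_le hbessel (y f n - f *+ n); lra.
(* Adding 1 allows inversion even when [C = 0]. *)
have C21 : 0 < C ^+ 2 + 1 by rewrite ltr_wpDl ?sqr_ge0.
exists (C ^+ 2 + 1)^-1; first by rewrite invr_gt0.
move=> f; rewrite mulrC ler_pdivrMr// -l2_norm_sqr.
have : rnorm f ^+ 2 <= C ^+ 2 * t f ^+ 2.
  by rewrite -exprMn ler_pXn2r ?nnegrE ?rnorm_ge0 ?mulr_ge0.
have := sqr_ge0 (t f); rewrite /t; lra.
Qed.

End Recovery.

Theorem theorem3p14 (R : realType) (k : scalar_kind) (N r : nat)
    (hN : (1 <= N)%N) (hr : (1 <= r <= 2 * N - 1)%N) (hodd : odd r)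
    (hcop : coprime r N)
    (H : completeNormedModType (base_field R k)) (dot : {dot H for @sconj R k})
    (hdot : norm_of_dot dot)
    (hinf : infinite_dimensional H) (hsep : separable H)
    (A : {linear H -> H}) (hA : bounded_operator A)
    (g : Lambda R N r -> H) (beta : R) (hbeta : 0 < beta)
    (hbessel : bessel dot beta g) :
  (exists K : nat, (1 <= K)%N /\ stably_recoverable A dot [set: H] g K) <->
  is_frame dot g.
Proof.
split=> [[K [_ hrec]]|hframe].
  exact: (recoverable_frame hN hr hA hbeta hbessel hrec).
by exists 1%N; split=> //; exact: (frame_recoverable hA hbeta hbessel hframe).
Qed.
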